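(* Let $k$ be a commutative ring, $A$ a unital cdg algebra over $k$, $C$ a counital dg coalgebra over $k$, $N$ a counital dg $C$-comodule and $\tau$ a solution of the Maurer-Cartan equation of the cdg algebra $\mathrm{Hom}^\bullet_k(C,A)$. The functor $$\mathcal CA\to\mathrm{Mod}\,k,\qquad M\mapsto T_\tau\mathrm{MC}(S^{-1}\mathrm{Hom}^\bullet_k(N,M))$$ is corepresentable. Denote by $N\otimes_\tau A$ (the cobar construction over $A$ of $N$) a corepresentative. Moreover, it can be chosen to yield a functor $$?\otimes_\tau A:\mathsf{Com}\,C\to\mathcal CA,\qquad N\mapsto N\otimes_\tau A$$ such that the isomorphism $(\mathcal CA)(N\otimes_\tau A,?)\xrightarrow{\sim}T_\tau\mathrm{MC}(S^{-1}\mathrm{Hom}^\bullet_k(N,?))$ is natural in $N$.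
   Context: $k$ is a commutative associative unital ring; graded means $\mathbf Z$-graded; $\otimes=\otimes_k$; Koszul sign rule $(f\otimes g)(u\otimes v)=(-1)^{|g||u|}f(u)\otimes g(v)$; $(S^{-1}V)^p=V^{p-1}$. A unital cdg (curved dg) algebra is a unital graded associative $k$-algebra $A$ (multiplication $m_2$, unit $\eta_A:k\to A$) with $c\in A^2$ (curvature) and a degree $1$ map $d=m_1:A\to A$ with $d(c)=0$, $d(d(a))=ca-ac$, $d(ab)=d(a)b+(-1)^{|a|}a\,d(b)$. A unital (right) cdg $A$-module is a unital graded right $A$-module $M$ (action $m_2^M$) with a degree $1$ map $d_M$ with $d_M(ma)=d_M(m)a+(-1)^{|m|}m\,d(a)$ and $d_M(d_M(m))=-mc$. $\mathcal CA$ is the category of unital cdg $A$-modules, with degree $0$ $A$-linear maps commuting with the $d$'s. A counital dg coalgebra is $(C,d_C,\Delta,\eta)$, coassociative graded with counit $\eta:C\to k$ and square-zero degree $1$ coderivation $d_C$. $\mathsf{Com}\,C$ is the category of counital dg right $C$-comodules $(N,d_N,\Delta_N)$. $\mathrm{Hom}^\bullet_k(C,A)$ (graded module of homogeneous $k$-linear maps) is a cdg algebra with curvature $c\,\eta(-)$, predifferential $f\mapsto m_1f-(-1)^{|f|}fd_C$ and multiplication $(f,g)\mapsto m_2(f\otimes g)\Delta$; a solution of its Maurer-Cartan equation is a degree $1$ map $\tau:C\to A$ with $c\,\eta(-)+(m_1\tau+\tau d_C)+m_2(\tau\otimes\tau)\Delta=0$. $T_\tau\mathrm{MC}(S^{-1}\mathrm{Hom}^\bullet_k(N,M))$,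 the tangent space in $\tau$ to the Maurer-Cartan equation of the cdg module $S^{-1}\mathrm{Hom}^\bullet_k(N,M)$ over $\mathrm{Hom}^\bullet_k(C,A)$, identifies with the $k$-module of degree $0$ $k$-linear maps $f:N\to M$ with $$d_Mf-fd_N-m_2^M(f\otimes\tau)\Delta_N=0.$$ It is functorial in $N$ by precomposition and in $M$ by postcomposition. *)

(* Defs.v *)
From HB Require Import structures.
From mathcomp Require Import all_boot all_order all_algebra.
From mathcomp Require Import all_classical.

Set Implicit Arguments.
Unset Strict Implicit.
Unset Printing Implicit Defensive.

Import GRing.Theory.
Local Open Scope ring_scope.
Local Open Scope quotient_scope.

(* The ground ring k is a comPzRingType and algebras carry their own
   multiplication m_2, rather than using comNzRingType and algType, so that
   neither k nor A is forced to be nonzero. *)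

Lemma lin_ext (k : pzRingType) (U V : lmodType k) (f g : {linear U -> V}) :
  f =1 g -> f = g.
Proof.
case: f g => [f cf] [g cg] /= /funext fg.
case: _ / fg cg => cg; congr GRing.Linear.Pack.
case: cf cg => [[a1] [a2]] [[b1] [b2]].
by rewrite (Prop_irrelevance a1 b1) (Prop_irrelevance a2 b2).
Qed.

Section LinModule.
Variables (k : comPzRingType) (U V : lmodType k).
Local Notation L := {linear U -> V}.
Implicit Types f g : L.

Lemma lin_zero_linear : linear (fun _ : U => 0 : V).
Proof. by move=> a u v; rewrite scaler0 addr0. Qed.
Lemma lin_opp_linear f : linear (fun u => - f u).
Proof. by move=> a u v; rewrite linearP opprD scalerN. Qed.
Lemma lin_add_linear f g : linear (fun u => f u + g u).
Proof. by move=> a u v; rewrite !linearP scalerDr addrACA. Qed.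
Lemma lin_scale_linear (a : k) f : linear (fun u => a *: f u).
Proof.
by move=> b u v; rewrite linearP scalerDr !scalerA mulrC.
Qed.

Definition mklin (f : U -> V) (fL : linear f) : L :=
  HB.pack f (GRing.isLinear.Build k U V *:%R f fL).

Definition lin_zero : L := mklin lin_zero_linear.
Definition lin_opp f : L := mklin (lin_opp_linear f).
Definition lin_add f g : L := mklin (lin_add_linear f g).
Definition lin_scale a f : L := mklin (lin_scale_linear a f).

Fact lin_addA : associative lin_add.
Proof. by move=> f g h; apply: lin_ext => u /=; rewrite addrA. Qed.
Fact lin_addC : commutative lin_add.
Proof. by move=> f g; apply: lin_ext => u /=; rewrite addrC. Qed.
Fact lin_add0 : left_id lin_zero lin_add.
Proof. by move=> f; apply: lin_ext => u /=; rewrite add0r. Qed.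
Fact lin_addN : left_inverse lin_zero lin_opp lin_add.
Proof. by move=> f; apply: lin_ext => u /=; rewrite addNr. Qed.

HB.instance Definition _ := gen_eqMixin L.
HB.instance Definition _ := gen_choiceMixin L.
HB.instance Definition _ :=
  GRing.isZmodule.Build L lin_addA lin_addC lin_add0 lin_addN.

Fact lin_scaleA a b f : lin_scale a (lin_scale b f) = lin_scale (a * b) f.
Proof. by apply: lin_ext => u /=; rewrite scalerA. Qed.
Fact lin_scale1 : left_id 1 lin_scale.
Proof. by move=> f; apply: lin_ext => u /=; rewrite scale1r. Qed.
Fact lin_scaleDr : right_distributive lin_scale +%R.
Proof. by move=> a f g; apply: lin_ext => u /=; rewrite scalerDr. Qed.
Fact lin_scaleDl f : {morph lin_scale^~ f : a b / a + b}.
Proof. by move=> a b; apply: lin_ext => u /=; rewrite scalerDl. Qed.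

HB.instance Definition _ :=
  GRing.Zmodule_isLmodule.Build k L lin_scaleA lin_scale1 lin_scaleDr lin_scaleDl.

Lemma linDE f g u : (f + g) u = f u + g u. Proof. by []. Qed.
Lemma linZE a f u : (a *: f) u = a *: f u. Proof. by []. Qed.
Lemma lin0E u : (0 : L) u = 0. Proof. by []. Qed.
Lemma linNE f u : (- f) u = - f u. Proof. by []. Qed.

End LinModule.

Section Tensor.
Variables (k : comPzRingType) (V W : lmodType k).

(* A tensor is a formal sum of pairs modulo the usual relations. Formal sums
   only form a monoid, so (0,0) = 0 does not follow from the other relations
   and must be imposed. *)
Inductive tens_rel : seq (V * W) -> seq (V * W) -> Prop :=
| TensRefl s : tens_rel s s
| TensSym s t : tens_rel s t -> tens_rel t s
| TensTrans s t u : tens_rel s t -> tens_rel t u -> tens_rel s u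
| TensCat s s' t t' :
    tens_rel s s' -> tens_rel t t' -> tens_rel (s ++ t) (s' ++ t')
| TensC s t : tens_rel (s ++ t) (t ++ s)
| Tens0 : tens_rel [:: (0, 0)] [::]
| TensDl v v' w : tens_rel [:: (v + v', w)] [:: (v, w); (v', w)]
| TensDr v w w' : tens_rel [:: (v, w + w')] [:: (v, w); (v, w')]
| TensZ a v w : tens_rel [:: (a *: v, w)] [:: (v, a *: w)].

Definition tens_relb : rel (seq (V * W)) := fun s t => `[< tens_rel s t >].
Fact tens_refl : reflexive tens_relb.
Proof. by move=> s; apply/asboolP/TensRefl. Qed.
Fact tens_sym : symmetric tens_relb.
Proof. by move=> s t; apply/asboolP/asboolP; apply: TensSym. Qed.
Fact tens_trans : transitive tens_relb.
Proof.
by move=> t s u /asboolP st /asboolP tu; apply/asboolP; apply: TensTrans tu.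
Qed.
Canonical tens_equiv := EquivRel tens_relb tens_refl tens_sym tens_trans.

Definition tens := {eq_quot tens_equiv}.
HB.instance Definition _ := Choice.on tens.
HB.instance Definition _ := EqQuotient.on tens.

Lemma tens_eqP s t : (\pi_tens s = \pi_tens t) <-> tens_rel s t.
Proof. by split=> [/eqmodP/asboolP|?] //; apply/eqmodP/asboolP. Qed.

Lemma tens_repr s : tens_rel (repr (\pi_tens s)) s.
Proof. by apply/tens_eqP; rewrite reprK. Qed.

Lemma tens_W (P : tens -> Prop) : (forall s, P (\pi_tens s)) -> forall x, P x.
Proof. by move=> Ppi x; rewrite -[x]reprK. Qed.

Definition pure (v : V) (w : W) : tens := \pi_tens [:: (v, w)].

Definition tens_zero : tens := \pi_tens [::].
Definition tens_add (x y : tens) : tens := \pi_tens (repr x ++ repr y).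
Definition scale_seq (a : k) (s : seq (V * W)) := [seq (a *: p.1, p.2) | p <- s].
Definition tens_scale (a : k) (x : tens) : tens :=
  \pi_tens (scale_seq a (repr x)).
Definition tens_opp := tens_scale (- 1).

Lemma tens_addE s t : tens_add (\pi_tens s) (\pi_tens t) = \pi_tens (s ++ t).
Proof. by apply/tens_eqP/TensCat; apply: tens_repr. Qed.

Lemma tens_rel0w w : tens_rel [:: (0, w)] [::].
Proof.
rewrite -(scale0r 0); apply: TensTrans (TensZ _ _ _) _.
by rewrite scale0r; apply: Tens0.
Qed.

Lemma scale_seq_rel a s t : tens_rel s t -> tens_rel (scale_seq a s) (scale_seq a t).
Proof.
elim=> {s t}.
- by move=> s; apply: TensRefl.
- by move=> s t _; apply: TensSym.
- by move=> s t u _ + _; apply: TensTrans.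
- by move=> s s' t t' _ hs _ ht; rewrite /scale_seq !map_cat; apply: TensCat.
- by move=> s t; rewrite /scale_seq !map_cat; apply: TensC.
- by rewrite /= scaler0; apply: Tens0.
- by move=> v v' w /=; rewrite scalerDr; apply: TensDl.
- by move=> v w w' /=; apply: TensDr.
- by move=> b v w /=; rewrite scalerA mulrC -scalerA; apply: TensZ.
Qed.

Lemma tens_scaleE a s : tens_scale a (\pi_tens s) = \pi_tens (scale_seq a s).
Proof. by apply/tens_eqP/scale_seq_rel/tens_repr. Qed.

Fact tens_addA : associative tens_add.
Proof.
by move=> x y z; elim/tens_W: x => s; elim/tens_W: y => t; elim/tens_W: z => u; rewrite !tens_addE catA.
Qed.
Fact tens_addC : commutative tens_add.
Proof.
by move=> x y; elim/tens_W: x => s; elim/tens_W: y => t; rewrite !tens_addE; apply/tens_eqP/TensC.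
Qed.
Fact tens_add0 : left_id tens_zero tens_add.
Proof. by move=> x; elim/tens_W: x => s; rewrite tens_addE. Qed.

Fact tens_scaleDl x : {morph tens_scale^~ x : a b / a + b >-> tens_add a b}.
Proof.
elim/tens_W: x => s a b; rewrite !tens_scaleE tens_addE; apply/tens_eqP.
elim: s => [|[v w] s IHs] /=; first exact: TensRefl.
rewrite -cat1s -[X in tens_rel _ X]cat1s.
apply: (@TensTrans _ ([:: (a *: v, w); (b *: v, w)] ++
                        (scale_seq a s ++ scale_seq b s))).
  by apply: TensCat IHs; rewrite scalerDl; apply: TensDl.
rewrite /= -cat1s -[X in tens_rel _ X]cat1s.
apply: TensCat; first exact: TensRefl.
rewrite -cat1s catA -[_ :: scale_seq b s]cat1s catA.
by apply: TensCat (TensC _ _) (TensRefl _).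
Qed.

Fact tens_scale0 x : tens_scale 0 x = tens_zero.
Proof.
elim/tens_W: x => s; rewrite tens_scaleE; apply/tens_eqP.
elim: s => [|[v w] s IHs] /=; first exact: TensRefl.
by rewrite scale0r -cat1s; apply: (TensCat (tens_rel0w w) IHs).
Qed.
Fact tens_scale1 : left_id 1 tens_scale.
Proof.
move=> x; elim/tens_W: x => s; rewrite tens_scaleE; congr (\pi_tens _).
by elim: s => [|[v w] s IHs] //=; rewrite scale1r IHs.
Qed.
Fact tens_addN : left_inverse tens_zero tens_opp tens_add.
Proof.
by move=> x; rewrite -{2}[x]tens_scale1 -tens_scaleDl addNr tens_scale0.
Qed.

HB.instance Definition _ :=
  GRing.isZmodule.Build tens tens_addA tens_addC tens_add0 tens_addN.

Lemma pi_add s t : (\pi_tens s : tens) + \pi_tens t = \pi_tens (s ++ t).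
Proof. exact: tens_addE. Qed.

Fact tens_scaleA a b x : tens_scale a (tens_scale b x) = tens_scale (a * b) x.
Proof.
elim/tens_W: x => s; rewrite !tens_scaleE; congr (\pi_tens _).
by elim: s => [|[v w] s IHs] //=; rewrite scalerA IHs.
Qed.
Fact tens_scaleDr : right_distributive tens_scale +%R.
Proof.
move=> a x y; elim/tens_W: x => s; elim/tens_W: y => t.
by rewrite pi_add !tens_scaleE pi_add /scale_seq map_cat.
Qed.

HB.instance Definition _ := GRing.Zmodule_isLmodule.Build k tens
  tens_scaleA tens_scale1 tens_scaleDr tens_scaleDl.

Lemma pi_scale a s : a *: (\pi_tens s : tens) = \pi_tens (scale_seq a s).
Proof. exact: tens_scaleE. Qed.

Lemma pureDl w : {morph pure^~ w : v v' / v + v'}.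
Proof. by move=> v v'; rewrite pi_add; apply/tens_eqP/TensDl. Qed.
Lemma pureDr v : {morph pure v : w w' / w + w'}.
Proof. by move=> w w'; rewrite pi_add; apply/tens_eqP/TensDr. Qed.
Lemma pureZl a v w : pure (a *: v) w = a *: pure v w.
Proof. by rewrite pi_scale. Qed.
Lemma pureZr a v w : pure v (a *: w) = a *: pure v w.
Proof. by rewrite -pureZl; apply/esym/tens_eqP/TensZ. Qed.

Lemma pure_linearl w : linear (pure^~ w).
Proof. by move=> a u v; rewrite pureDl pureZl. Qed.
Lemma pure_linearr v : linear (pure v).
Proof. by move=> a u w; rewrite pureDr pureZr. Qed.

Lemma pure0l w : pure 0 w = 0.
Proof. exact: linear0 (mklin (pure_linearl w)). Qed.
Lemma pure0r v : pure v 0 = 0.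
Proof. exact: linear0 (mklin (pure_linearr v)). Qed.
Lemma pure_suml I (r : seq I) F w :
  pure (\sum_(i <- r) F i) w = \sum_(i <- r) pure (F i) w.
Proof. exact: (linear_sum (mklin (pure_linearl w))). Qed.
Lemma pure_sumr I (r : seq I) F v :
  pure v (\sum_(i <- r) F i) = \sum_(i <- r) pure v (F i).
Proof. exact: (linear_sum (mklin (pure_linearr v))). Qed.

Lemma pi_tensE s : \pi_tens s = \sum_(p <- s) pure p.1 p.2.
Proof.
elim: s => [|[v w] s IHs]; first by rewrite big_nil.
by rewrite big_cons -IHs pi_add.
Qed.

Lemma tens_ind (P : tens -> Prop) :
  P 0 -> (forall x y, P x -> P y -> P (x + y)) -> (forall v w, P (pure v w)) ->
  forall x, P x.
Proof.
move=> P0 PD Pp; elim/tens_W=> s; rewrite pi_tensE.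
by elim: s => [|p s IHs]; rewrite ?big_nil ?big_cons //; apply: PD.
Qed.

Section Lift.
Variables (X : lmodType k) (f : V -> W -> X).
Hypotheses (fl : forall w, linear (f^~ w)) (fr : forall v, linear (f v)).

Definition tens_lift_fun (x : tens) : X := \sum_(p <- repr x) f p.1 p.2.

Lemma lift_rel s t : tens_rel s t ->
  \sum_(p <- s) f p.1 p.2 = \sum_(p <- t) f p.1 p.2.
Proof.
have fDl w v v' : f (v + v') w = f v w + f v' w := linearD (mklin (fl w)) v v'.
have fDr v w w' : f v (w + w') = f v w + f v w' := linearD (mklin (fr v)) w w'.
have f0 v : f v 0 = 0 := linear0 (mklin (fr v)).
elim=> {s t}.
- by [].
- by move=> s t _ ->.
- by move=> s t u _ -> _ ->.
- by move=> s s' t t' _ hs _ ht; rewrite !big_cat /= hs ht.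
- by move=> s t; rewrite !big_cat /= addrC.
- by rewrite big_seq1 big_nil /= f0.
- by move=> v v' w; rewrite !big_cons !big_nil /= !addr0 fDl.
- by move=> v w w'; rewrite !big_cons !big_nil /= !addr0 fDr.
- move=> a v w; rewrite !big_seq1 /=.
  by have /= -> := linearZ_LR (mklin (fl w)) a v; have /= -> := linearZ_LR (mklin (fr v)) a w.
Qed.

Lemma tens_liftE s : tens_lift_fun (\pi_tens s) = \sum_(p <- s) f p.1 p.2.
Proof. exact/lift_rel/tens_repr. Qed.

Lemma tens_lift_linear : linear tens_lift_fun.
Proof.
move=> a x y; elim/tens_W: x => s; elim/tens_W: y => t.
rewrite pi_scale pi_add !tens_liftE.
rewrite big_cat big_map /= scaler_sumr; congr (_ + _).
by apply: eq_bigr => p _; have /= -> := linearZ_LR (mklin (fl p.2)) a p.1.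
Qed.

Definition tens_lift : {linear tens -> X} := mklin tens_lift_linear.

Lemma tens_lift_pure v w : tens_lift (pure v w) = f v w.
Proof. by rewrite /= tens_liftE big_seq1. Qed.

End Lift.

Lemma tens_ext (X : lmodType k) (f g : {linear tens -> X}) :
  (forall v w, f (pure v w) = g (pure v w)) -> f =1 g.
Proof.
move=> fg; apply: tens_ind => //; first by rewrite !linear0.
by move=> x y; rewrite !linearD => -> ->.
Qed.

End Tensor.

Notation "V ⊗ W" := (tens V W) (at level 40, left associativity).
Notation "v ⊗ₜ w" := (pure v w) (at level 40, left associativity) : ring_scope.

Section TensorMaps.
Variable k : comPzRingType.

Section Map.
Variables (V V' W W' : lmodType k) (f : {linear V -> V'}) (g : {linear W -> W'}).

Lemma tmap_linearl w : linear (fun v => f v ⊗ₜ g w).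
Proof. by move=> a u v; rewrite linearP pureDl pureZl. Qed.
Lemma tmap_linearr v : linear (fun w => f v ⊗ₜ g w).
Proof. by move=> a u w; rewrite linearP pureDr pureZr. Qed.

(* f ⊗ g without the Koszul sign; see koszul below. *)
Definition tmap : {linear V ⊗ W -> V' ⊗ W'} :=
  tens_lift tmap_linearl tmap_linearr.

Lemma tmap_pure v w : tmap (v ⊗ₜ w) = f v ⊗ₜ g w.
Proof. exact: tens_lift_pure. Qed.
End Map.

Section Assoc.
Variables U V W : lmodType k.

Lemma assoc_linearr w u : linear (fun v => u ⊗ₜ (v ⊗ₜ w) : U ⊗ (V ⊗ W)).
Proof. by move=> a v v'; rewrite pureDl pureZl pureDr pureZr. Qed.
Lemma assoc_linearl w v : linear (fun u => u ⊗ₜ (v ⊗ₜ w) : U ⊗ (V ⊗ W)).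
Proof. by move=> a u u'; rewrite pureDl pureZl. Qed.
Definition assoc_at w : {linear U ⊗ V -> U ⊗ (V ⊗ W)} :=
  tens_lift (assoc_linearl w) (assoc_linearr w).
Lemma assoc_at_linear x : linear (assoc_at^~ x).
Proof.
move=> a w w'; cbv beta; elim/tens_ind: x => [|x y hx hy|u v].
- by rewrite !linear0 addr0.
- by rewrite !(linearD (assoc_at _)) hx hy scalerDr addrACA.
- by rewrite !tens_lift_pure !(pureDr, pureZr).
Qed.
Lemma assoc_at_linearl w : linear (assoc_at w). Proof. exact: linearP. Qed.

Definition tassoc : {linear (U ⊗ V) ⊗ W -> U ⊗ (V ⊗ W)} :=
  tens_lift assoc_at_linearl assoc_at_linear.
Lemma tassoc_pure u v w : tassoc ((u ⊗ₜ v) ⊗ₜ w) = u ⊗ₜ (v ⊗ₜ w).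
Proof.
rewrite [LHS](tens_lift_pure assoc_at_linearl assoc_at_linear).
exact: (tens_lift_pure (assoc_linearl w) (assoc_linearr w)).
Qed.
End Assoc.

Section Unitors.
Variable V : lmodType k.

Lemma tunitl_linearl (v : V) : linear (fun a : k^o => (a : k) *: v).
Proof. by move=> a b c; rewrite scalerDl scalerA. Qed.
Lemma tunitl_linearr (a : k^o) : linear (fun v : V => (a : k) *: v).
Proof. by move=> b u v; rewrite scalerDr !scalerA mulrC. Qed.

Definition tunitl : {linear k^o ⊗ V -> V} :=
  tens_lift tunitl_linearl tunitl_linearr.
Definition tunitr : {linear V ⊗ k^o -> V} :=
  @tens_lift _ _ _ _ (fun (v : V) (a : k^o) => (a : k) *: v)
    tunitl_linearr tunitl_linearl.
Lemma tunitl_pure a v : tunitl (a ⊗ₜ v) = (a : k) *: v.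
Proof. exact: tens_lift_pure. Qed.
Lemma tunitr_pure v a : tunitr (v ⊗ₜ a) = (a : k) *: v.
Proof. exact: tens_lift_pure. Qed.
End Unitors.

End TensorMaps.

(* A graded module (V^p)_p is represented by its total module V = ⊕_p V^p
   together with the projections gproj p : V -> V onto the summands V^p, so
   that the total module of a graded tensor product is the tensor product of
   the total modules. *)
HB.mixin Record isGraded (k : comPzRingType) V of GRing.Lmodule k V := {
  gproj_fun : int -> V -> V;
  gproj_linear : forall p, linear (gproj_fun p);
  gprojK_subproof : forall p q v,
    gproj_fun p (gproj_fun q v) = if p == q then gproj_fun q v else 0;
  gproj_sum_subproof : forall v,
    exists2 s : seq int, uniq s & v = \sum_(p <- s) gproj_fun p v
}.

#[short(type="gradedModType")]
HB.structure Definition GradedModule (k : comPzRingType) :=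
  {V of GRing.Lmodule k V & isGraded k V}.

Section LocallyFinite.
Variables (k : comPzRingType) (V X : lmodType k) (F : int -> {linear V -> X}).
Hypothesis lfF : forall v, exists s : seq int, forall p, p \notin s -> F p v = 0.

Definition lfsum_fun v := \sum_(p \in [set: int]) F p v.

Lemma lfsum_funE s v : uniq s -> (forall p, p \notin s -> F p v = 0) ->
  lfsum_fun v = \sum_(p <- s) F p v.
Proof.
move=> us Fs; rewrite /lfsum_fun (fsbigE s) //=; last by move=> p _; apply: Fs.
by apply: eq_bigl => p; rewrite in_setT.
Qed.

Lemma lfsum_linear : linear lfsum_fun.
Proof.
move=> a u v; have [s us] := lfF u; have [t vt] := lfF v.
pose r := undup (s ++ t).
have ru p : p \notin r -> F p u = 0.
  by rewrite mem_undup mem_cat negb_or => /andP[/us].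
have rv p : p \notin r -> F p v = 0.
  by rewrite mem_undup mem_cat negb_or => /andP[_ /vt].
have r_uniq : uniq r := undup_uniq _.
rewrite (lfsum_funE r_uniq ru) (lfsum_funE r_uniq rv) (@lfsum_funE r) //; last first.
  by move=> p pr; rewrite linearP ru // rv // scaler0 addr0.
by rewrite scaler_sumr -big_split /=; apply: eq_bigr => p _; rewrite linearP.
Qed.

Definition lfsum : {linear V -> X} := mklin lfsum_linear.

Lemma lfsumE s v : uniq s -> (forall p, p \notin s -> F p v = 0) ->
  lfsum v = \sum_(p <- s) F p v.
Proof. exact: lfsum_funE. Qed.
End LocallyFinite.

Section GradedTheory.
Variables (k : comPzRingType) (V : gradedModType k).

Definition gproj (p : int) : {linear V -> V} := mklin (@gproj_linear k V p).

(* v lies in V^p *)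
Definition homog (p : int) (v : V) := gproj p v = v.

Lemma gprojK p q v : gproj p (gproj q v) = if p == q then gproj q v else 0.
Proof. exact: gprojK_subproof. Qed.
Lemma homog_gproj p v : homog p (gproj p v).
Proof. by rewrite /homog gprojK eqxx. Qed.
Lemma gproj_homog p q v : homog q v -> gproj p v = if p == q then v else 0.
Proof. by move=> hv; rewrite -hv gprojK hv. Qed.

Lemma gproj_sum v : exists s : seq int,
  [/\ uniq s, v = \sum_(p <- s) gproj p v
    & forall p, p \notin s -> gproj p v = 0].
Proof.
have [s us vE] := gproj_sum_subproof v; exists s; split=> // p ps.
rewrite vE linear_sum big1_seq // => q /andP[_ qs].
by rewrite [LHS]gprojK; case: eqP ps => // ->; rewrite qs.
Qed.

Lemma ksign_lf (n : int) (v : V) : exists s : seq int, forall p, p \notin s ->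
  ((-1) ^+ absz (p * n) *: gproj p : {linear V -> V}) v = 0.
Proof.
have [s [_ _ vs]] := gproj_sum v; exists s => p ps.
by rewrite linZE vs // scaler0.
Qed.

(* v |-> (-1)^(|v| n) v *)
Definition ksign (n : int) : {linear V -> V} := lfsum (ksign_lf n).

Lemma ksign_homog n p v : homog p v -> ksign n v = (-1) ^+ absz (p * n) *: v.
Proof.
move=> hv; rewrite (@lfsumE _ _ _ _ _ [:: p]) // ?big_seq1 ?linZE ?hv //.
by move=> q; rewrite inE linZE (gproj_homog _ hv) => /negPf->; rewrite scaler0.
Qed.

End GradedTheory.
Arguments gproj {k V} p.
Arguments ksign {k V} n.

(* f is homogeneous of degree n: f (V^p) ⊆ W^(p+n) *)
Definition has_degree (k : comPzRingType) (V W : gradedModType k) (n : int)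
  (f : V -> W) := forall p v, homog p v -> homog (p + n) (f v).

(* f ⊗ g with the Koszul sign, for g homogeneous of degree n:
   u ⊗ v |-> (-1)^(|u| n) f u ⊗ g v *)
Definition koszul (k : comPzRingType) (V : gradedModType k) (V' W W' : lmodType k)
    (n : int) (f : {linear V -> V'}) (g : {linear W -> W'}) :
    {linear V ⊗ W -> V' ⊗ W'} :=
  tmap (f \o ksign n) g.

Section GradedUnit.
Variable k : comPzRingType.
Definition unit_proj (p : int) (a : k^o) : k^o := if p == 0 then a else 0.
Fact unit_proj_linear p : linear (unit_proj p).
Proof.
by move=> a u v; rewrite /unit_proj; case: eqP; rewrite ?scaler0 ?addr0.
Qed.
Fact unit_projK p q a :
  unit_proj p (unit_proj q a) = if p == q then unit_proj q a else 0.
Proof.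
rewrite /unit_proj; case: (eqVneq q 0) => [->|]; last by rewrite !if_same.
by case: eqP.
Qed.
Fact unit_proj_sum a : exists2 s : seq int, uniq s & a = \sum_(p <- s) unit_proj p a.
Proof. by exists [:: 0] => //; rewrite big_seq1. Qed.
HB.instance Definition _ :=
  isGraded.Build k k^o unit_proj_linear unit_projK unit_proj_sum.
End GradedUnit.

Section GradedTensor.
Variables (k : comPzRingType) (V W : gradedModType k).

Lemma tens_homog_ind (P : V ⊗ W -> Prop) :
  P 0 -> (forall x y, P x -> P y -> P (x + y)) ->
  (forall p q v w, homog p v -> homog q w -> P (v ⊗ₜ w)) -> forall x, P x.
Proof.
move=> P0 PD Pp; apply: tens_ind => // v w.
have [s [_ -> _]] := gproj_sum v; have [t [_ -> _]] := gproj_sum w.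
have -> : (\sum_(p <- s) gproj p v) ⊗ₜ (\sum_(q <- t) gproj q w)
  = \sum_(p <- s) \sum_(q <- t) gproj p v ⊗ₜ gproj q w.
  by rewrite pure_suml; apply: eq_bigr => p _; rewrite pure_sumr.
apply: big_ind => // p _; apply: big_ind => // q _.
by apply: (Pp p q); apply: homog_gproj.
Qed.

Lemma tproj_homog i j p q (v : V) (w : W) : homog p v -> homog q w ->
  tmap (gproj i) (gproj j) (v ⊗ₜ w) = if (i == p) && (j == q) then v ⊗ₜ w else 0.
Proof.
move=> hv hw; rewrite tmap_pure (gproj_homog _ hv) (gproj_homog _ hw).
by case: eqP => _ /=; rewrite ?pure0l //; case: eqP => _; rewrite ?pure0r.
Qed.

Lemma tproj_lf (n : int) (x : V ⊗ W) : exists s : seq int, forall p, p \notin s ->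
  (tmap (gproj p) (gproj (n - p)) : {linear V ⊗ W -> V ⊗ W}) x = 0.
Proof.
elim/tens_homog_ind: x => [|x y [s hs] [t ht]|p q v w hv hw].
- by exists [::] => p _; rewrite linear0.
- exists (s ++ t) => p; rewrite mem_cat negb_or => /andP[ps pt].
  by rewrite linearD hs // ht // addr0.
- by exists [:: p] => i; rewrite inE (tproj_homog _ _ hv hw) => /negPf->.
Qed.

(* (V ⊗ W)^n = ⊕_p V^p ⊗ W^(n-p) *)
Definition tproj (n : int) : {linear V ⊗ W -> V ⊗ W} := lfsum (tproj_lf n).

Lemma tproj_pure n p q (v : V) (w : W) : homog p v -> homog q w ->
  tproj n (v ⊗ₜ w) = if n == p + q then v ⊗ₜ w else 0.
Proof.
move=> hv hw; rewrite (@lfsumE _ _ _ _ _ [:: p]) //.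
  by rewrite big_seq1 (tproj_homog _ _ hv hw) eqxx /= subr_eq addrC.
by move=> i; rewrite inE (tproj_homog _ _ hv hw) => /negPf->.
Qed.

Fact tproj_linear p : linear (tproj p). Proof. exact: linearP. Qed.
Fact tprojK p q x : tproj p (tproj q x) = if p == q then tproj q x else 0.
Proof.
elim/tens_homog_ind: x => [|x y hx hy|i j v w hv hw].
- by rewrite !linear0 if_same.
- by rewrite !linearD hx hy; case: eqP => _; rewrite ?addr0.
- rewrite (tproj_pure _ hv hw); case: (eqVneq q (i + j)) => [->|_].
    by rewrite (tproj_pure _ hv hw).
  by rewrite linear0 if_same.
Qed.
Fact tproj_sum x : exists2 s : seq int, uniq s & x = \sum_(p <- s) tproj p x.
Proof.
suff [s Hs] : exists s : seq int, forall t, uniq t -> {subset s <= t} ->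
    x = \sum_(p <- t) tproj p x.
  exists (undup s); first exact: undup_uniq.
  by apply: Hs (undup_uniq s) _ => p; rewrite mem_undup.
elim/tens_homog_ind: x => [|x y [s hs] [t ht]|i j v w hv hw].
- by exists [::] => t _ _; rewrite big1 // => p _; rewrite linear0.
- exists (s ++ t) => r ur sr.
  under eq_bigr do rewrite linearD.
  rewrite big_split /= -hs // -?ht // => p ps; apply: sr;
    by rewrite mem_cat ps ?orbT.
- exists [:: i + j] => t ut st.
  rewrite (bigD1_seq (i + j)) ?st ?inE // (tproj_pure _ hv hw) eqxx.
  by rewrite big1 ?[RHS]addr0 // => p /negPf pn; rewrite (tproj_pure _ hv hw) pn.
Qed.

HB.instance Definition _ := GRing.Lmodule.on (V ⊗ W).
HB.instance Definition _ :=
  isGraded.Build k (V ⊗ W) tproj_linear tprojK tproj_sum.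

Lemma homog_pure p q (v : V) (w : W) :
  homog p v -> homog q w -> homog (p + q) (v ⊗ₜ w).
Proof. by move=> hv hw; have := tproj_pure (p + q) hv hw; rewrite eqxx. Qed.
Lemma koszul_pure (V' W' : lmodType k) n (f : {linear V -> V'})
    (g : {linear W -> W'}) p v w : homog p v ->
  koszul n f g (v ⊗ₜ w) = (-1) ^+ absz (p * n) *: (f v ⊗ₜ g w).
Proof.
move=> hv; rewrite tmap_pure -[_ v]/(f (ksign n v)) (ksign_homog _ hv).
by rewrite linearZ_LR pureZl.
Qed.
End GradedTensor.

Section HasDegree.
Variable k : comPzRingType.

Lemma homog_lin (V : gradedModType k) p a (u v : V) :
  homog p u -> homog p v -> homog p (a *: u + v).
Proof. by move=> hu hv; rewrite /homog linearP hu hv. Qed.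
Lemma homog0 (V : gradedModType k) p : homog p (0 : V).
Proof. exact: linear0. Qed.

Lemma has_degree_lin (V W : gradedModType k) n a (f g : {linear V -> W}) :
  has_degree n f -> has_degree n g -> has_degree n (a *: f + g).
Proof. by move=> hf hg p v hv; apply: homog_lin; [apply: hf|apply: hg]. Qed.
Lemma has_degree0 (V W : gradedModType k) n : has_degree n (0 : {linear V -> W}).
Proof. by move=> p v _; apply: homog0. Qed.
Lemma has_degree_id (V : gradedModType k) : has_degree 0 (idfun : V -> V).
Proof. by move=> p v; rewrite addr0. Qed.
Lemma has_degree_comp (U V W : gradedModType k) (g : V -> W) (f : U -> V) :
  has_degree 0 g -> has_degree 0 f -> has_degree 0 (g \o f).
Proof. by move=> hg hf p v hv; have := hg _ _ (hf _ _ hv); rewrite addr0. Qed.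
End HasDegree.

(* The Leibniz rules are stated for a homogeneous left factor; the unit map
   η_A : k -> A is given by the element cdga_one = η_A 1. *)
Record cdgAlgebra (k : comPzRingType) := CdgAlgebra {
  cdga_sort :> gradedModType k;
  cdga_mul : {linear cdga_sort ⊗ cdga_sort -> cdga_sort};
  cdga_one : cdga_sort;
  cdga_curv : cdga_sort;
  cdga_d : {linear cdga_sort -> cdga_sort};
  cdga_mul_deg : has_degree 0 cdga_mul;
  cdga_mulA : forall a b c : cdga_sort,
    cdga_mul (cdga_mul (a ⊗ₜ b) ⊗ₜ c) = cdga_mul (a ⊗ₜ cdga_mul (b ⊗ₜ c));
  cdga_one_homog : homog 0 cdga_one;
  cdga_mul1l : forall a, cdga_mul (cdga_one ⊗ₜ a) = a;
  cdga_mul1r : forall a, cdga_mul (a ⊗ₜ cdga_one) = a;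
  cdga_d_deg : has_degree 1 cdga_d;
  cdga_curv_homog : homog 2 cdga_curv;
  cdga_d_curv : cdga_d cdga_curv = 0;
  cdga_dd : forall a, cdga_d (cdga_d a) =
    cdga_mul (cdga_curv ⊗ₜ a) - cdga_mul (a ⊗ₜ cdga_curv);
  cdga_leibniz : forall p (a b : cdga_sort), homog p a ->
    cdga_d (cdga_mul (a ⊗ₜ b)) =
    cdga_mul (cdga_d a ⊗ₜ b) + (-1) ^+ absz p *: cdga_mul (a ⊗ₜ cdga_d b)
}.
Arguments cdga_mul {k} _.
Arguments cdga_one {k} _.
Arguments cdga_curv {k} _.
Arguments cdga_d {k} _.

Record cdgModule (k : comPzRingType) (A : cdgAlgebra k) := CdgModule {
  cdgm_sort :> gradedModType k;
  cdgm_act : {linear cdgm_sort ⊗ A -> cdgm_sort};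
  cdgm_d : {linear cdgm_sort -> cdgm_sort};
  cdgm_act_deg : has_degree 0 cdgm_act;
  cdgm_actA : forall (m : cdgm_sort) (a b : A),
    cdgm_act (cdgm_act (m ⊗ₜ a) ⊗ₜ b) = cdgm_act (m ⊗ₜ cdga_mul A (a ⊗ₜ b));
  cdgm_act1 : forall m, cdgm_act (m ⊗ₜ cdga_one A) = m;
  cdgm_d_deg : has_degree 1 cdgm_d;
  cdgm_leibniz : forall p (m : cdgm_sort) (a : A), homog p m ->
    cdgm_d (cdgm_act (m ⊗ₜ a)) =
    cdgm_act (cdgm_d m ⊗ₜ a) + (-1) ^+ absz p *: cdgm_act (m ⊗ₜ cdga_d A a);
  cdgm_dd : forall m, cdgm_d (cdgm_d m) = - cdgm_act (m ⊗ₜ cdga_curv A)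
}.
Arguments cdgm_act {k A} _.
Arguments cdgm_d {k A} _.

(* η d_C = 0 is not imposed: composing dgc_coder with η ⊗ η gives
   η d_C = 2 η d_C. *)
Record dgCoalgebra (k : comPzRingType) := DgCoalgebra {
  dgc_sort :> gradedModType k;
  dgc_comul : {linear dgc_sort -> dgc_sort ⊗ dgc_sort};
  dgc_counit : {linear dgc_sort -> k^o};
  dgc_d : {linear dgc_sort -> dgc_sort};
  dgc_comul_deg : has_degree 0 dgc_comul;
  dgc_comulA : forall x,
    tassoc _ _ _ (tmap dgc_comul idfun (dgc_comul x)) =
    tmap idfun dgc_comul (dgc_comul x);
  dgc_counit_deg : has_degree 0 dgc_counit;
  dgc_counitl : forall x, tunitl _ (tmap dgc_counit idfun (dgc_comul x)) = x;
  dgc_counitr : forall x, tunitr _ (tmap idfun dgc_counit (dgc_comul x)) = x;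
  dgc_d_deg : has_degree 1 dgc_d;
  dgc_dd : forall x, dgc_d (dgc_d x) = 0;
  dgc_coder : forall x, dgc_comul (dgc_d x) =
    koszul 0 dgc_d idfun (dgc_comul x) + koszul 1 idfun dgc_d (dgc_comul x)
}.
Arguments dgc_comul {k} _.
Arguments dgc_counit {k} _.
Arguments dgc_d {k} _.

Record dgComodule (k : comPzRingType) (C : dgCoalgebra k) := DgComodule {
  dgn_sort :> gradedModType k;
  dgn_coact : {linear dgn_sort -> dgn_sort ⊗ C};
  dgn_d : {linear dgn_sort -> dgn_sort};
  dgn_coact_deg : has_degree 0 dgn_coact;
  dgn_coactA : forall x,
    tassoc _ _ _ (tmap dgn_coact idfun (dgn_coact x)) =
    tmap idfun (dgc_comul C) (dgn_coact x);
  dgn_counit : forall x,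
    tunitr _ (tmap idfun (dgc_counit C) (dgn_coact x)) = x;
  dgn_d_deg : has_degree 1 dgn_d;
  dgn_dd : forall x, dgn_d (dgn_d x) = 0;
  dgn_coder : forall x, dgn_coact (dgn_d x) =
    koszul 0 dgn_d idfun (dgn_coact x) + koszul 1 idfun (dgc_d C) (dgn_coact x)
}.
Arguments dgn_coact {k C} _.
Arguments dgn_d {k C} _.

Section CdgHom.
Variables (k : comPzRingType) (A : cdgAlgebra k) (M M' : cdgModule A).

Definition is_cdg_hom (f : {linear M -> M'}) : Prop :=
  [/\ has_degree 0 f,
      forall (m : M) (a : A), f (cdgm_act M (m ⊗ₜ a)) = cdgm_act M' (f m ⊗ₜ a)
    & forall m, f (cdgm_d M m) = cdgm_d M' (f m)].

Definition cdg_hom_pred : {pred {linear M -> M'}} := fun f => `[< is_cdg_hom f >].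

Record cdgHom := CdgHom {
  cdg_hom_lin :> {linear M -> M'};
  cdg_hom_mem : cdg_hom_lin \in cdg_hom_pred
}.

Lemma cdgHomP (f : cdgHom) : is_cdg_hom f.
Proof. by case: f => f /= /asboolP. Qed.

Fact cdg_hom_submod : submod_closed cdg_hom_pred.
Proof.
split=> [|b f g /asboolP[hf fm fd] /asboolP[hg gm gd]]; apply/asboolP.
  by split=> [|m a|m]; rewrite ?lin0E ?pure0l ?linear0 //; apply: has_degree0.
split=> [|m a|m]; rewrite ?linDE ?linZE.
- exact: has_degree_lin.
- by rewrite fm gm pureDl pureZl linearP.
- by rewrite fd gd linearP.
Qed.

HB.instance Definition _ := [isSub for cdg_hom_lin].
HB.instance Definition _ := [Choice of cdgHom by <:].
HB.instance Definition _ :=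
  GRing.isSubmodClosed.Build k {linear M -> M'} cdg_hom_pred cdg_hom_submod.
HB.instance Definition _ := [SubChoice_isSubLmodule of cdgHom by <:].
End CdgHom.

Section ComHom.
Variables (k : comPzRingType) (C : dgCoalgebra k) (N N' : dgComodule C).

Definition is_com_hom (g : {linear N -> N'}) : Prop :=
  [/\ has_degree 0 g,
      forall x, dgn_coact N' (g x) = tmap g idfun (dgn_coact N x)
    & forall x, g (dgn_d N x) = dgn_d N' (g x)].

Record comHom := ComHom {
  com_hom_lin :> {linear N -> N'};
  comHomP : is_com_hom com_hom_lin
}.

Lemma comHom_ext (f g : comHom) : f =1 g -> f = g.
Proof.
case: f g => [f hf] [g hg] /= /lin_ext fg; case: _ / fg hg => hg.
by rewrite (Prop_irrelevance hf hg).
Qed.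
End ComHom.

Lemma cdgHom_ext (k : comPzRingType) (A : cdgAlgebra k) (M M' : cdgModule A)
  (f g : cdgHom M M') : f =1 g -> f = g.
Proof. by move=> /lin_ext/val_inj. Qed.

Section MaurerCartan.
Variables (k : comPzRingType) (A : cdgAlgebra k) (C : dgCoalgebra k).

(* Curvature, predifferential and multiplication of Hom_k(C, A), on
   homogeneous maps, the degrees of f and g being given by p and q. *)
Lemma hom_curv_linear :
  linear (fun x : C => (dgc_counit C x : k) *: cdga_curv A).
Proof. by move=> a x y; rewrite linearP scalerDl scalerA. Qed.
Definition hom_curv : {linear C -> A} := mklin hom_curv_linear.
Definition hom_d (p : int) (f : {linear C -> A}) : {linear C -> A} :=
  (cdga_d A \o f : {linear C -> A})
  - (-1) ^+ absz p *: (f \o dgc_d C : {linear C -> A}).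
Definition hom_mul (q : int) (f g : {linear C -> A}) : {linear C -> A} :=
  cdga_mul A \o koszul q f g \o dgc_comul C.

Record mcSolution := McSolution {
  mc_lin :> {linear C -> A};
  mc_deg : has_degree 1 mc_lin;
  mc_eq : hom_curv + hom_d 1 mc_lin + hom_mul 1 mc_lin mc_lin = 0
}.

Section Tangent.
Variables (tau : mcSolution) (N : dgComodule C) (M : cdgModule A).

(* The action on f in Hom_k(N, M) of g in Hom_k(C, A), of degree q. *)
Definition hom_act (q : int) (f : {linear N -> M}) (g : {linear C -> A}) :
    {linear N -> M} :=
  cdgm_act M \o koszul q f g \o dgn_coact N.

Definition is_tangent (f : {linear N -> M}) : Prop :=
  has_degree 0 f /\
  (cdgm_d M \o f : {linear N -> M}) - (f \o dgn_d N : {linear N -> M})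
    - hom_act 1 f tau = 0.

Definition tangent_pred : {pred {linear N -> M}} := fun f => `[< is_tangent f >].

(* T_τ MC (S^-1 Hom_k(N, M)), as a submodule of the linear maps N -> M *)
Record tangent := Tangent {
  tangent_lin :> {linear N -> M};
  tangent_mem : tangent_lin \in tangent_pred
}.

Lemma tangentP (f : tangent) : is_tangent f.
Proof. by case: f => f /= /asboolP. Qed.

Lemma is_tangentE f : is_tangent f <-> has_degree 0 f /\
  forall x, cdgm_d M (f x) - f (dgn_d N x)
    - cdgm_act M (koszul 1 f tau (dgn_coact N x)) = 0.
Proof.
split=> -[fdeg fE]; split=> //.
  by move=> x; have /(congr1 (fun h : {linear N -> M} => h x)) := fE.
by apply: lin_ext => x; apply: fE.
Qed.

Lemma tmap_linP (V V' W W' : lmodType k) a (f g : {linear V -> V'})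
    (h : {linear W -> W'}) x :
  tmap (a *: f + g) h x = a *: tmap f h x + tmap g h x.
Proof.
elim/tens_ind: x => [|x y hx hy|v w].
- by rewrite !linear0 addr0.
- by rewrite !(linearD (tmap _ _)) hx hy scalerDr addrACA.
- by rewrite !tmap_pure pureDl pureZl.
Qed.

Lemma koszul_linP (V : gradedModType k) (V' W W' : lmodType k) q a
    (f g : {linear V -> V'}) (h : {linear W -> W'}) x :
  koszul q (a *: f + g) h x = a *: koszul q f h x + koszul q g h x.
Proof.
rewrite -tmap_linP; congr (tmap _ _ x); exact: lin_ext.
Qed.

Fact tangent_submod : submod_closed tangent_pred.
Proof.
split=> [|a f g]; last first.
  move=> /asboolP/is_tangentE[hf fE] /asboolP/is_tangentE[hg gE].
  apply/asboolP/is_tangentE; split=> [|x]; first exact: has_degree_lin.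
  rewrite koszul_linP !linDE !linZE (linearP (cdgm_d M)) (linearP (cdgm_act M)).
  rewrite !opprD -!scalerN (addrACA (a *: cdgm_d M (f x))).
  rewrite (addrACA (a *: _ + a *: _)) -!scalerDr.
  by rewrite fE gE scaler0 addr0.
apply/asboolP/is_tangentE; split=> [|x]; first exact: has_degree0.
have := koszul_linP 1 (-1) (0 : {linear N -> M}) 0 tau (dgn_coact N x).
by rewrite scaler0 addr0 scaleN1r addNr => ->; rewrite !lin0E !linear0 ?subr0 ?addr0.
Qed.

HB.instance Definition _ := [isSub for tangent_lin].
HB.instance Definition _ := [Choice of tangent by <:].
HB.instance Definition _ :=
  GRing.isSubmodClosed.Build k {linear N -> M} tangent_pred tangent_submod.
HB.instance Definition _ := [SubChoice_isSubLmodule of tangent by <:].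
End Tangent.

Lemma tangent_ext (tau : mcSolution) (N : dgComodule C) (M : cdgModule A)
  (f g : tangent tau N M) : f =1 g -> f = g.
Proof. by move=> /lin_ext/val_inj. Qed.

End MaurerCartan.

Record category := Category {
  cat_ob :> Type;
  cat_hom : cat_ob -> cat_ob -> Type;
  cat_id : forall X, cat_hom X X;
  cat_comp : forall X Y Z, cat_hom Y Z -> cat_hom X Y -> cat_hom X Z;
  cat_comp1l : forall X Y (f : cat_hom X Y), cat_comp (cat_id Y) f = f;
  cat_comp1r : forall X Y (f : cat_hom X Y), cat_comp f (cat_id X) = f;
  cat_compA : forall X Y Z T (h : cat_hom Z T) (g : cat_hom Y Z) (f : cat_hom X Y),
    cat_comp h (cat_comp g f) = cat_comp (cat_comp h g) f
}.
Arguments cat_hom {c} X Y.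
Arguments cat_id {c} X.
Arguments cat_comp {c X Y Z} g f.

Record functor (C D : category) := Functor {
  functor_ob :> C -> D;
  functor_map : forall X Y, cat_hom X Y -> cat_hom (functor_ob X) (functor_ob Y);
  functor_map1 : forall X, functor_map (cat_id X) = cat_id (functor_ob X);
  functor_mapM : forall X Y Z (g : cat_hom Y Z) (f : cat_hom X Y),
    functor_map (cat_comp g f) = cat_comp (functor_map g) (functor_map f)
}.
Arguments functor_map {C D} f {X Y} u : rename.

Record nat_trans (C D : category) (F G : functor C D) := NatTrans {
  nt_fun :> forall X : C, cat_hom (F X) (G X);
  nt_natural : forall (X Y : C) (u : cat_hom X Y),
    cat_comp (nt_fun Y) (functor_map F u) = cat_comp (functor_map G u) (nt_fun X)
}.

Definition is_iso (C : category) (X Y : C) (f : cat_hom X Y) :=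
  exists g : cat_hom Y X, cat_comp g f = cat_id X /\ cat_comp f g = cat_id Y.

Record nat_iso (C D : category) (F G : functor C D) := NatIso {
  ni_trans :> nat_trans F G;
  ni_iso : forall X, is_iso (ni_trans X)
}.

Section Categories.
Variable k : comPzRingType.

Definition lin_id (U : lmodType k) : {linear U -> U} := idfun.
Definition lin_comp (U V W : lmodType k) (g : {linear V -> W})
  (f : {linear U -> V}) : {linear U -> W} := g \o f.

Program Definition ModCat : category := @Category (lmodType k)
  (fun U V => {linear U -> V}) lin_id lin_comp _ _ _.
Next Obligation. by move=> *; apply: lin_ext. Qed.
Next Obligation. by move=> *; apply: lin_ext. Qed.
Next Obligation. by move=> *; apply: lin_ext. Qed.

Section CdgCat.
Variable A : cdgAlgebra k.

Fact cdg_id_subproof (M : cdgModule A) : (idfun : {linear M -> M}) \in @cdg_hom_pred k A M M.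
Proof. by apply/asboolP; split=> //; apply: has_degree_id. Qed.
Definition cdg_id (M : cdgModule A) : cdgHom M M := CdgHom (cdg_id_subproof M).

Fact cdg_comp_subproof (L M P : cdgModule A) (g : cdgHom M P) (f : cdgHom L M) :
  (g \o f : {linear L -> P}) \in @cdg_hom_pred k A L P.
Proof.
have [hg gm gd] := cdgHomP g; have [hf fm fd] := cdgHomP f.
apply/asboolP; split=> [|m a|m] /=; first exact: has_degree_comp.
- by rewrite fm gm.
- by rewrite fd gd.
Qed.
Definition cdg_comp (L M P : cdgModule A) (g : cdgHom M P) (f : cdgHom L M) :
  cdgHom L P := CdgHom (cdg_comp_subproof g f).

Program Definition CdgModCat : category :=
  @Category (cdgModule A) (@cdgHom k A) cdg_id cdg_comp _ _ _.
Next Obligation. by move=> *; apply: cdgHom_ext. Qed.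
Next Obligation. by move=> *; apply: cdgHom_ext. Qed.
Next Obligation. by move=> *; apply: cdgHom_ext. Qed.

Fact cdg_postcomp_linear (X M M' : cdgModule A) (u : cdgHom M M') :
  linear (fun f : cdgHom X M => cdg_comp u f).
Proof. by move=> a f g; apply: cdgHom_ext => x; apply: linearP. Qed.

(* (CA)(X, ?) with its k-module structure *)
Program Definition corep_functor (X : cdgModule A) : functor CdgModCat ModCat :=
  @Functor CdgModCat ModCat (fun M => cdgHom X M)
    (fun M M' u => mklin (cdg_postcomp_linear (X := X) u)) _ _.
Next Obligation. by move=> *; apply: lin_ext => f; apply: cdgHom_ext. Qed.
Next Obligation. by move=> *; apply: lin_ext => f; apply: cdgHom_ext. Qed.

Definition corepresentable (T : functor CdgModCat ModCat) :=
  exists X : cdgModule A, inhabited (nat_iso (corep_functor X) T).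

End CdgCat.

Section ComCat.
Variable C : dgCoalgebra k.

Fact com_id_subproof (N : dgComodule C) : is_com_hom (idfun : {linear N -> N}).
Proof.
split=> [|x|//]; first exact: has_degree_id.
by elim/tens_ind: (dgn_coact N x) => [|y z hy hz|v w];
  rewrite ?linear0 ?linearD -?hy -?hz ?tmap_pure.
Qed.
Definition com_id (N : dgComodule C) : comHom N N := ComHom (com_id_subproof N).

Lemma tmap_comp (U V W U' V' W' : lmodType k) (g : {linear V -> W})
    (f : {linear U -> V}) (g' : {linear V' -> W'}) (f' : {linear U' -> V'}) x :
  tmap (g \o f) (g' \o f') x = tmap g g' (tmap f f' x).
Proof.
by elim/tens_ind: x => [|y z hy hz|v w];
  rewrite ?linear0 ?linearD -?hy -?hz ?tmap_pure.
Qed.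

Fact com_comp_subproof (L N P : dgComodule C) (g : comHom N P) (f : comHom L N) :
  is_com_hom (g \o f : {linear L -> P}).
Proof.
have [hg gm gd] := comHomP g; have [hf fm fd] := comHomP f.
split=> [|x|x] /=; first exact: has_degree_comp.
- by rewrite gm fm -tmap_comp; congr (tmap _ _ _); apply: lin_ext.
- by rewrite fd gd.
Qed.
Definition com_comp (L N P : dgComodule C) (g : comHom N P) (f : comHom L N) :
  comHom L P := ComHom (com_comp_subproof g f).

Program Definition ComCat : category :=
  @Category (dgComodule C) (@comHom k C) com_id com_comp _ _ _.
Next Obligation. by move=> *; apply: comHom_ext. Qed.
Next Obligation. by move=> *; apply: comHom_ext. Qed.
Next Obligation. by move=> *; apply: comHom_ext. Qed.
End ComCat.

Section TangentFunctor.
Variables (A : cdgAlgebra k) (C : dgCoalgebra k) (tau : mcSolution A C).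

Fact tangent_post_subproof (N : dgComodule C) (M M' : cdgModule A)
    (u : cdgHom M M') (f : tangent tau N M) :
  (u \o f : {linear N -> M'}) \in @tangent_pred k A C tau N M'.
Proof.
have [hu um ud] := cdgHomP u; have /is_tangentE[hf fE] := tangentP f.
have uact y : u (cdgm_act M y) = cdgm_act M' (tmap u idfun y).
  by elim/tens_ind: y => [|y z hy hz|v w];
    rewrite ?linear0 ?linearD ?hy ?hz ?tmap_pure.
have kE y : koszul 1 (u \o f : {linear N -> M'}) tau y =
    tmap u idfun (koszul 1 f tau y).
  by rewrite -tmap_comp; congr (tmap _ _ y); apply: lin_ext.
apply/asboolP/is_tangentE; split=> [|x]; first exact: has_degree_comp.
by rewrite kE -uact [X in X - _ - _]/= -ud -!linearB fE linear0.
Qed.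
Definition tangent_post N M M' (u : cdgHom M M') (f : tangent tau N M) :
  tangent tau N M' := Tangent (tangent_post_subproof u f).
Fact tangent_post_linear N M M' (u : cdgHom M M') :
  linear (@tangent_post N M M' u).
Proof. by move=> a f g; apply: tangent_ext => x; apply: linearP. Qed.

Lemma ksign_natural (V W : gradedModType k) n (g : {linear V -> W}) v :
  has_degree 0 g -> ksign n (g v) = g (ksign n v).
Proof.
move=> hg; have [s [_ -> _]] := gproj_sum v.
rewrite (linear_sum g) (linear_sum (ksign n)) (linear_sum (ksign n)) (linear_sum g).
apply: eq_bigr => p _; have hp := homog_gproj p v.
have := hg _ _ hp; rewrite addr0 => hgp.
by rewrite (ksign_homog _ hgp) (ksign_homog _ hp) linearZ_LR.
Qed.

Fact tangent_pre_subproof (N N' : dgComodule C) (M : cdgModule A)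
    (g : comHom N N') (f : tangent tau N' M) :
  (f \o g : {linear N -> M}) \in @tangent_pred k A C tau N M.
Proof.
have [hg gm gd] := comHomP g; have /is_tangentE[hf fE] := tangentP f.
have kE y : koszul 1 (f \o g : {linear N -> M}) tau y =
    koszul 1 f tau (tmap g idfun y).
  elim/tens_ind: y => [|y z hy hz|v c]; first by rewrite !linear0.
    by rewrite (linearD (koszul _ _ _)) hy hz !linearD.
  rewrite /koszul !tmap_pure /cat_comp; congr (f _ ⊗ₜ _).
  by rewrite (ksign_natural 1 v hg).
apply/asboolP/is_tangentE; split=> [|x]; first exact: has_degree_comp.
by rewrite kE -gm [X in _ - X - _]/= gd fE.
Qed.
Definition tangent_pre N N' M (g : comHom N N') (f : tangent tau N' M) :
  tangent tau N M := Tangent (tangent_pre_subproof g f).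
Fact tangent_pre_linear N N' M (g : comHom N N') :
  linear (@tangent_pre N N' M g).
Proof. by move=> a f h; apply: tangent_ext. Qed.

(* M |-> T_τ MC (S^-1 Hom_k(N, M)), functorial by postcomposition *)
Program Definition TMC (N : dgComodule C) : functor (CdgModCat A) ModCat :=
  @Functor (CdgModCat A) ModCat (fun M => tangent tau N M)
    (fun M M' u => mklin (tangent_post_linear (N := N) u)) _ _.
Next Obligation. by move=> *; apply: lin_ext => f; apply: tangent_ext. Qed.
Next Obligation. by move=> *; apply: lin_ext => f; apply: tangent_ext. Qed.

Program Definition TMC_pre (N N' : dgComodule C) (g : comHom N N') :
    nat_trans (TMC N') (TMC N) :=
  @NatTrans _ _ (TMC N') (TMC N) (fun M => mklin (tangent_pre_linear (M := M) g)) _.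
Next Obligation. by move=> *; apply: lin_ext => f; apply: tangent_ext. Qed.

End TangentFunctor.

(* (CA)(?, M) on a morphism h : X -> X' *)
Section CorepPre.
Variables (A : cdgAlgebra k) (X X' : cdgModule A) (h : cdgHom X X').
Fact cdg_precomp_linear (M : cdgModule A) :
  linear (fun f : cdgHom X' M => cdg_comp f h).
Proof. by move=> a f g; apply: cdgHom_ext. Qed.
Program Definition corep_pre : nat_trans (corep_functor X') (corep_functor X) :=
  @NatTrans _ _ (corep_functor X') (corep_functor X)
    (fun M => mklin (cdg_precomp_linear (M := M))) _.
Next Obligation. by move=> *; apply: lin_ext => f; apply: cdgHom_ext. Qed.
End CorepPre.

End Categories.

(* Main.v *)
Require Import Defs.
From HB Require Import structures.
From mathcomp Require Import all_boot all_order all_algebra.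
From mathcomp Require Import all_classical.
From mathcomp Require Import zify.

(** The corepresentative is the free graded A-module N ⊗ A with a twisted
    predifferential.  An A-linear map F out of N ⊗ A is the same thing as its
    restriction f : n |-> F (n ⊗ 1), and a degree 1 map D on N ⊗ A satisfying the
    Leibniz rule is the same thing as the degree 1 map
    delta : n |-> D (n ⊗ 1).  Taking

      delta n = d_N n ⊗ 1 + (1 ⊗ tau) (Delta_N n),

    the condition F D = d_M F, which need only be tested on the generators
    n ⊗ 1, reads f d_N + m_2^M (f ⊗ tau) Delta_N = d_M f, which is the tangent
    equation ([tangent_cobarE]).  So restriction to the generators is the
    required isomorphism.

    What has to be verified is that D is indeed a predifferential, that is
    D (D x) = - x c.  By the Leibniz rule it is enough that
    D (delta n) = - n ⊗ c ([free_dd]).  Expanding D (delta n), the terms with d_N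
    cancel by the coderivation property of d_N; the term quadratic in tau, which
    comes from applying Delta_N twice, becomes 1 ⊗ (m_2 (tau ⊗ tau) Delta_C) by
    coassociativity; and the Maurer-Cartan equation together with
    counitality turns the rest into - n ⊗ c ([cobar_twist_eq],
    [cobar_delta_dd]).

    Functoriality in N is then formal: g : N -> N' is sent to the morphism that
    corepresentability attaches to the pullback along g of the universal tangent
    vector of N'.

    All Koszul signs are carried by the linear operator [ksign 1], which
    multiplies V^p by (-1)^p.  The sign computations thus become identities between
    linear maps, and rest on the facts that this operator squares to the identity,
    commutes with maps of degree 0, anticommutes with maps of degree 1, and acts
    diagonally on tensor products. *)

Set Implicit Arguments.
Unset Strict Implicit.
Unset Printing Implicit Defensive.

Import GRing.Theory.
Local Open Scope ring_scope.

(** * The sign operator of a graded module *)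

Section Sign.
Variable k : comPzRingType.

Lemma sign_abszD (p q : int) :
  (-1) ^+ absz (p + q) = (-1) ^+ absz p * (-1) ^+ absz q :> k.
Proof.
rewrite -exprD -[LHS]signr_odd -[RHS]signr_odd; congr ((-1) ^+ (nat_of_bool _)).
lia.
Qed.

Lemma homogD (V : gradedModType k) p (u v : V) :
  homog p u -> homog p v -> homog p (u + v).
Proof. by move=> hu hv; rewrite -[u]scale1r; apply: homog_lin. Qed.

Lemma homogZ (V : gradedModType k) p a (v : V) : homog p v -> homog p (a *: v).
Proof. by move=> hv; rewrite -[_ *: _]addr0; apply: homog_lin (homog0 _ _). Qed.

Lemma homog_ind (V : gradedModType k) (P : V -> Prop) :
  P 0 -> (forall x y, P x -> P y -> P (x + y)) ->
  (forall p v, homog p v -> P v) -> forall v, P v.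
Proof.
move=> P0 PD Ph v; have [s [_ -> _]] := gproj_sum v.
by apply: big_ind => // p _; apply/Ph/homog_gproj.
Qed.

Lemma ksign1_homog (V : gradedModType k) p (v : V) :
  homog p v -> ksign 1 v = (-1) ^+ absz p *: v.
Proof. by move=> hv; rewrite (ksign_homog _ hv) mulr1. Qed.

Lemma ksign1K (V : gradedModType k) (v : V) : ksign 1 (ksign 1 v) = v.
Proof.
elim/homog_ind: v => [|x y hx hy|p v hv].
- by rewrite !linear0.
- by rewrite !linearD hx hy.
- rewrite (ksign1_homog hv) linearZ_LR (ksign1_homog hv) scalerA.
  by rewrite -expr2 sqrr_sign scale1r.
Qed.

Lemma ksign1_odd (V W : gradedModType k) (g : {linear V -> W}) v :
  has_degree 1 g -> ksign 1 (g v) = - g (ksign 1 v).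
Proof.
move=> hg; elim/homog_ind: v => [|x y hx hy|p v hv].
- by rewrite !linear0.
- by rewrite !linearD hx hy.
- rewrite (ksign1_homog (hg _ _ hv)) (ksign1_homog hv) linearZ_LR sign_abszD.
  by rewrite expr1 mulrN1 scaleNr.
Qed.

Lemma ksign1_pure (V W : gradedModType k) (v : V) (w : W) :
  ksign 1 (v ⊗ₜ w) = ksign 1 v ⊗ₜ ksign 1 w.
Proof.
rewrite -tmap_pure.
elim/tens_homog_ind: (v ⊗ₜ w) => [|x y hx hy|p q {}v {}w hv hw].
- by rewrite !linear0.
- by rewrite !linearD hx hy.
- rewrite tmap_pure (ksign1_homog hv) (ksign1_homog hw).
  by rewrite (ksign1_homog (homog_pure hv hw)) pureZl pureZr scalerA sign_abszD.
Qed.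

Lemma ksign0 (V : gradedModType k) (v : V) : ksign 0 v = v.
Proof.
elim/homog_ind: v => [|x y hx hy|p v hv].
- by rewrite linear0.
- by rewrite linearD hx hy.
- by rewrite (ksign_homog _ hv) mulr0 expr0 scale1r.
Qed.

Lemma koszul1_pure (V : gradedModType k) (V' W W' : lmodType k)
    (f : {linear V -> V'}) (g : {linear W -> W'}) v w :
  koszul 1 f g (v ⊗ₜ w) = f (ksign 1 v) ⊗ₜ g w.
Proof. exact: tmap_pure. Qed.

Lemma pureNl (V W : lmodType k) (v : V) (w : W) : (- v) ⊗ₜ w = - (v ⊗ₜ w).
Proof. by rewrite -!scaleN1r pureZl. Qed.

Lemma pureNr (V W : lmodType k) (v : V) (w : W) : v ⊗ₜ (- w) = - (v ⊗ₜ w).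
Proof. by rewrite -!scaleN1r pureZr. Qed.

(** The degree p part of a tensor product is spanned by the pure tensors of
    homogeneous elements whose degrees add up to p. *)
Lemma tens_has_degree (V W X : gradedModType k) n (h : {linear V ⊗ W -> X}) :
  (forall p q v w, homog p v -> homog q w -> homog (p + q + n) (h (v ⊗ₜ w))) ->
  has_degree n h.
Proof.
move=> hh p x hx; rewrite -hx.
elim/tens_homog_ind: x {hx} => [|x y hx hy|i j v w hv hw].
- by rewrite !linear0; apply: homog0.
- by rewrite !linearD; apply: homogD.
- rewrite -[gproj p _]/(tproj _ _ p _) (tproj_pure _ hv hw).
  case: eqP => [->|_]; first exact: hh.
  by rewrite linear0; apply: homog0.
Qed.

End Sign.

(** * Free graded modules over a cdg algebra *)

Section FreeModule.
Variables (k : comPzRingType) (A : cdgAlgebra k) (N : gradedModType k).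

(** With the sign absorbed into [ksign 1], both sides are linear in a, so the
    Leibniz rule extends from homogeneous a to all a. *)
Lemma cdga_leibniz1 (a b : A) :
  cdga_d A (cdga_mul A (a ⊗ₜ b)) =
  cdga_mul A (cdga_d A a ⊗ₜ b) + cdga_mul A (ksign 1 a ⊗ₜ cdga_d A b).
Proof.
elim/homog_ind: a => [|x y hx hy|p a ha].
- by rewrite !(pure0l, linear0) addr0.
- by rewrite !(pureDl, linearD) hx hy addrACA.
- by rewrite (cdga_leibniz _ ha) (ksign1_homog ha) pureZl linearZ_LR.
Qed.

(** The Leibniz rule on 1 = 1 * 1 gives d 1 = d 1 + d 1. *)
Lemma cdga_d1 : cdga_d A (cdga_one A) = 0.
Proof.
have := cdga_leibniz (cdga_one A) (cdga_one_homog A).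
rewrite expr0 scale1r !cdga_mul1l cdga_mul1r => /eqP.
by rewrite -subr_eq subrr eq_sym => /eqP.
Qed.

Definition free_gen : {linear N -> N ⊗ A} := mklin (pure_linearl (cdga_one A)).

Definition free_act : {linear (N ⊗ A) ⊗ A -> N ⊗ A} :=
  tmap idfun (cdga_mul A) \o tassoc N A A.

Lemma free_act_pure n (a b : A) :
  free_act ((n ⊗ₜ a) ⊗ₜ b) = n ⊗ₜ cdga_mul A (a ⊗ₜ b).
Proof. by rewrite -[LHS]/(tmap _ _ (tassoc _ _ _ _)) tassoc_pure tmap_pure. Qed.

Lemma free_actD x y (b : A) :
  free_act ((x + y) ⊗ₜ b) = free_act (x ⊗ₜ b) + free_act (y ⊗ₜ b).
Proof. by rewrite pureDl linearD. Qed.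

Lemma free_act_deg : has_degree 0 free_act.
Proof.
apply: tens_has_degree => p q x a hx ha; rewrite addr0 -hx.
elim/tens_homog_ind: x {hx} => [|x y hx hy|i j v w hv hw].
- by rewrite linear0 pure0l linear0; apply: homog0.
- by rewrite linearD free_actD; apply: homogD.
- rewrite -[gproj p _]/(tproj _ _ p _) (tproj_pure _ hv hw); case: eqP => [->|_].
    rewrite free_act_pure -addrA; apply: homog_pure => //.
    by have := cdga_mul_deg (homog_pure hw ha); rewrite addr0.
  by rewrite pure0l linear0; apply: homog0.
Qed.

Lemma free_actA (x : N ⊗ A) (a b : A) :
  free_act (free_act (x ⊗ₜ a) ⊗ₜ b) = free_act (x ⊗ₜ cdga_mul A (a ⊗ₜ b)).
Proof.
elim/tens_ind: x => [|x y hx hy|n c].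
- by rewrite !(pure0l, linear0).
- by rewrite !free_actD hx hy.
- by rewrite !free_act_pure cdga_mulA.
Qed.

Lemma free_act1 (x : N ⊗ A) : free_act (x ⊗ₜ cdga_one A) = x.
Proof.
elim/tens_ind: x => [|x y hx hy|n c].
- by rewrite !(pure0l, linear0).
- by rewrite free_actD hx hy.
- by rewrite free_act_pure cdga_mul1r.
Qed.

Section Predifferential.
Variable delta : {linear N -> N ⊗ A}.
Hypothesis delta_deg : has_degree 1 delta.

(** The derivation of N ⊗ A over d_A with prescribed restriction delta to the
    generators: n ⊗ a |-> delta n . a + (-1)^|n| n ⊗ d a. *)
Definition free_d : {linear N ⊗ A -> N ⊗ A} :=
  (free_act \o tmap delta idfun : {linear N ⊗ A -> N ⊗ A})
  + koszul 1 idfun (cdga_d A).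

Lemma free_d_pure n (a : A) :
  free_d (n ⊗ₜ a) = free_act (delta n ⊗ₜ a) + ksign 1 n ⊗ₜ cdga_d A a.
Proof.
rewrite linDE -[X in X + _]/(free_act (tmap delta idfun (n ⊗ₜ a))).
by rewrite tmap_pure koszul1_pure.
Qed.

Lemma free_d1 n : free_d (n ⊗ₜ cdga_one A) = delta n.
Proof. by rewrite free_d_pure cdga_d1 pure0r addr0 free_act1. Qed.

Lemma free_d_deg : has_degree 1 free_d.
Proof.
apply: tens_has_degree => p q n a hn ha; rewrite free_d_pure.
apply: homogD.
  have := free_act_deg (homog_pure (delta_deg hn) ha).
  by rewrite addr0 addrAC.
rewrite (ksign1_homog hn) pureZl; apply: homogZ.
by rewrite -addrA; apply: homog_pure => //; apply: cdga_d_deg.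
Qed.

Lemma free_leibniz1 (x : N ⊗ A) (b : A) :
  free_d (free_act (x ⊗ₜ b)) =
  free_act (free_d x ⊗ₜ b) + free_act (ksign 1 x ⊗ₜ cdga_d A b).
Proof.
elim/tens_ind: x => [|x y hx hy|n a].
- by rewrite !(pure0l, linear0) addr0.
- rewrite (linearD (ksign 1)) (linearD free_d) (free_actD x) (linearD free_d) hx hy.
  by rewrite (free_actD (free_d x)) (free_actD (ksign 1 x)) addrACA.
- rewrite free_act_pure !free_d_pure free_actD free_actA ksign1_pure !free_act_pure.
  by rewrite cdga_leibniz1 pureDr addrA.
Qed.

Lemma free_leibniz p (x : N ⊗ A) (b : A) : homog p x ->
  free_d (free_act (x ⊗ₜ b)) =
  free_act (free_d x ⊗ₜ b) + (-1) ^+ absz p *: free_act (x ⊗ₜ cdga_d A b).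
Proof.
by move=> hx; rewrite free_leibniz1 (ksign1_homog hx) pureZl linearZ_LR.
Qed.

(** The square of a derivation over d_A differs from right multiplication by - c
    by an A-linear map, because d_A squares to the commutator with c; hence the
    generators decide. *)
Lemma free_dd : (forall n, free_d (delta n) = - (n ⊗ₜ cdga_curv A)) ->
  forall x, free_d (free_d x) = - free_act (x ⊗ₜ cdga_curv A).
Proof.
move=> dd; elim/tens_ind => [|x y hx hy|n a].
- by rewrite !(pure0l, linear0).
- by rewrite (linearD free_d x) (linearD free_d (free_d x)) hx hy free_actD opprD.
(* The cross terms delta (ksign n) . d a cancel since delta is odd. *)
- rewrite free_d_pure linearD free_leibniz1 dd ksign1_odd // free_d_pure ksign1K.
  rewrite !pureNl !linearN !free_act_pure cdga_dd.
  by rewrite -addrA addKr pureDr pureNr addKr.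
Qed.

Section Extension.
Hypothesis delta_dd : forall n, free_d (delta n) = - (n ⊗ₜ cdga_curv A).

Definition free_cdgModule : cdgModule A :=
  CdgModule free_act_deg free_actA free_act1 free_d_deg free_leibniz
    (free_dd delta_dd).

Variable M : cdgModule A.

Lemma cdgm_leibniz1 (m : M) (a : A) :
  cdgm_d M (cdgm_act M (m ⊗ₜ a)) =
  cdgm_act M (cdgm_d M m ⊗ₜ a) + cdgm_act M (ksign 1 m ⊗ₜ cdga_d A a).
Proof.
elim/homog_ind: m => [|x y hx hy|p m hm].
- by rewrite !(pure0l, linear0) addr0.
- by rewrite !(pureDl, linearD) hx hy addrACA.
- by rewrite (cdgm_leibniz _ hm) (ksign1_homog hm) pureZl linearZ_LR.
Qed.

(** The A-linear extension of f: n ⊗ a |-> f n . a. *)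
Definition free_extend (f : {linear N -> M}) : {linear N ⊗ A -> M} :=
  cdgm_act M \o tmap f idfun.

Lemma free_extend_pure f n (a : A) :
  free_extend f (n ⊗ₜ a) = cdgm_act M (f n ⊗ₜ a).
Proof. by rewrite -[LHS]/(cdgm_act M (tmap _ _ _)) tmap_pure. Qed.

Lemma free_extend_act f (x : N ⊗ A) (a : A) :
  free_extend f (free_act (x ⊗ₜ a)) = cdgm_act M (free_extend f x ⊗ₜ a).
Proof.
elim/tens_ind: x => [|x y hx hy|n b].
- by rewrite !(pure0l, linear0).
- by rewrite free_actD (linearD (free_extend f)) hx hy linearD pureDl linearD.
- by rewrite free_act_pure !free_extend_pure cdgm_actA.
Qed.

Lemma free_extend_deg (f : {linear N -> M}) :
  has_degree 0 f -> has_degree 0 (free_extend f).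
Proof.
move=> hf; apply: tens_has_degree => p q n a hn ha; rewrite free_extend_pure.
by apply/cdgm_act_deg/homog_pure => //; have := hf _ _ hn; rewrite addr0.
Qed.

(** Both sides of F D = d_M F obey the same Leibniz rule, so it suffices to
    compare them on generators, where D is delta. *)
Lemma free_extend_hom (f : {linear N -> M}) : has_degree 0 f ->
  (forall n, free_extend f (delta n) = cdgm_d M (f n)) ->
  @is_cdg_hom k A free_cdgModule M (free_extend f).
Proof.
move=> hf fd; split=> [|x a|x]; first exact: free_extend_deg.
  exact: free_extend_act.
rewrite -[cdgm_d free_cdgModule x]/(free_d x).
elim/tens_ind: x => [|x y hx hy|n a].
- by rewrite !linear0.
- rewrite (linearD free_d) (linearD (free_extend f) (free_d x)) hx hy.
  by rewrite (linearD (free_extend f) x) linearD.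
- rewrite free_d_pure linearD free_extend_act fd !free_extend_pure.
  by rewrite cdgm_leibniz1 ksign_natural.
Qed.

Lemma free_hom_extend (F : cdgHom free_cdgModule M) (f : {linear N -> M}) :
  (forall n, F (n ⊗ₜ cdga_one A) = f n) -> F =1 free_extend f.
Proof.
have [_ Fact _] := cdgHomP F => Ff.
apply: (tens_ext (f := F : {linear N ⊗ A -> M})) => n a.
rewrite free_extend_pure -Ff -Fact; congr (F _).
by rewrite -[cdgm_act _ _]/(free_act _) free_act_pure cdga_mul1l.
Qed.

End Extension.
End Predifferential.
End FreeModule.

(** * The cobar construction *)

Section Cobar.
Variables (k : comPzRingType) (A : cdgAlgebra k) (C : dgCoalgebra k).
Variable tau : mcSolution A C.

Lemma mc_eqE x : cdga_d A (tau x) + tau (dgc_d C x) =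
  - ((dgc_counit C x : k) *: cdga_curv A)
  - cdga_mul A (koszul 1 tau tau (dgc_comul C x)).
Proof.
have /(congr1 (fun h : {linear C -> A} => h x)) := mc_eq tau.
rewrite /hom_d expr1 scaleN1r opprK => /eqP.
by rewrite !linDE addrAC addrC addr_eq0 -opprD => /eqP.
Qed.

Section Comodule.
Variable N : dgComodule C.

(** The map 1 ⊗ tau: n ⊗ x |-> (-1)^|n| n ⊗ tau x. *)
Definition twist : {linear N ⊗ C -> N ⊗ A} := koszul 1 idfun tau.

Lemma twist_deg : has_degree 1 twist.
Proof.
apply: tens_has_degree => p q n x hn hx; rewrite koszul1_pure (ksign1_homog hn).
rewrite linearZ_LR pureZl; apply: homogZ.
by rewrite -addrA; apply: homog_pure => //; apply: mc_deg.
Qed.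

Definition cobar_delta : {linear N -> N ⊗ A} :=
  (free_gen A N \o dgn_d N : {linear N -> N ⊗ A})
  + (twist \o dgn_coact N : {linear N -> N ⊗ A}).

Lemma cobar_deltaE n :
  cobar_delta n = dgn_d N n ⊗ₜ cdga_one A + twist (dgn_coact N n).
Proof. by []. Qed.

Lemma cobar_delta_deg : has_degree 1 cobar_delta.
Proof.
move=> p n hn; rewrite cobar_deltaE; apply: homogD.
  rewrite -[_ + 1]addr0.
  by apply: homog_pure; [apply: dgn_d_deg|apply: cdga_one_homog].
by have := twist_deg (dgn_coact_deg hn); rewrite addr0.
Qed.

(** The map 1 ⊗ m_2 (tau ⊗ tau), through which both terms quadratic in tau
    factor. *)
Definition twist2 : {linear N ⊗ (C ⊗ C) -> N ⊗ A} :=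
  tmap idfun (cdga_mul A \o koszul 1 tau tau).

Lemma twist2_pure n z :
  twist2 (n ⊗ₜ z) = n ⊗ₜ cdga_mul A (koszul 1 tau tau z).
Proof. exact: tmap_pure. Qed.

(** The sign operator on N ⊗ C contributes (-1)^|n| and (-1)^|y| on n ⊗ y; the
    first cancels the sign of [twist], the second is the Koszul sign of
    tau ⊗ tau. *)
Lemma twist2_assoc z x :
  twist2 (tassoc _ _ _ (z ⊗ₜ x)) = free_act A N (twist (ksign 1 z) ⊗ₜ tau x).
Proof.
elim/tens_ind: z => [|y z hy hz|n y].
- by rewrite !(pure0l, linear0).
- by rewrite pureDl (linearD (ksign 1)) !linearD hy hz pureDl linearD.
- rewrite tassoc_pure twist2_pure koszul1_pure ksign1_pure koszul1_pure ksign1K.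
  by rewrite free_act_pure.
Qed.

(** Applied to y = Delta_N n, the right-hand side is n ⊗ c by counitality. *)
Lemma curvature_counit y :
  tmap idfun (hom_curv A C) y =
  tunitr _ (tmap idfun (dgc_counit C) y) ⊗ₜ cdga_curv A :> N ⊗ A.
Proof.
elim/tens_ind: y => [|y z hy hz|n x].
- by rewrite !(pure0l, linear0).
- by rewrite !linearD hy hz pureDl.
- by rewrite !tmap_pure [tunitr _ _]tens_lift_pure pureZl -pureZr.
Qed.

(** For y = Delta_N n the left-hand side is D (delta n), by the coderivation
    property of d_N and d_N d_N = 0, and the last difference vanishes by
    coassociativity.  Stated for arbitrary y in N ⊗ C, the identity can be checked on pure tensors, where
    it reduces to the Maurer-Cartan equation. *)
Lemma cobar_twist_eq y :
  twist (koszul 0 (dgn_d N) idfun y) + twist (koszul 1 idfun (dgc_d C) y)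
    + free_d cobar_delta (twist y) =
  - tmap idfun (hom_curv A C) y
    + (twist2 (tassoc _ _ _ (tmap (dgn_coact N) idfun y))
       - twist2 (tmap idfun (dgc_comul C) y)).
Proof.
elim/tens_ind: y => [|y z hy hz|n x].
- by rewrite !linear0 !addr0.
- rewrite (linearD (koszul 0 (dgn_d N) idfun)) (linearD (koszul 1 idfun (dgc_d C))).
  rewrite !(linearD twist) (linearD (free_d _)) (linearD (tmap idfun (hom_curv A C))).
  rewrite (linearD (tmap (dgn_coact N) idfun)) (linearD (tmap idfun (dgc_comul C))).
  rewrite (linearD (tassoc _ _ _)) !(linearD twist2).
  rewrite !opprD (addrACA _ _ (twist _)) (addrACA (_ + _) _ (free_d _ _)) hy hz.
  by rewrite (addrACA (twist2 _)) [LHS]addrACA.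
- rewrite !koszul1_pure [koszul 0 _ _ _]tmap_pure.
  rewrite -[_ n]/(dgn_d N (ksign 0 n)) ksign0.
  rewrite (tmap_pure (dgn_coact N)) twist2_assoc (tmap_pure _ (dgc_comul C)) twist2_pure.
  rewrite (tmap_pure _ (hom_curv A C)) !koszul1_pure.
  rewrite ksign1K ksign1_odd; last exact: dgn_d_deg.
  rewrite free_d_pure cobar_deltaE free_actD free_act_pure cdga_mul1l ksign1K.
  rewrite (ksign_natural 1 n (@dgn_coact_deg _ _ N)).
  (* The two d_N terms cancel; the terms tau d_C and d_A tau are the linear part of
     the Maurer-Cartan equation, and the remaining term is quadratic in tau. *)
  rewrite -[LHS]/((- dgn_d N (ksign 1 n)) ⊗ₜ tau x + n ⊗ₜ tau (dgc_d C x) +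
    (dgn_d N (ksign 1 n) ⊗ₜ tau x +
     free_act A N (twist (dgn_coact N (ksign 1 n)) ⊗ₜ tau x) +
     n ⊗ₜ cdga_d A (tau x))).
  rewrite pureNl -[_ + _ + n ⊗ₜ _]addrA addrACA addNr add0r addrCA -pureDr.
  by rewrite [tau _ + _]addrC mc_eqE pureDr !pureNr addrCA.
Qed.

Lemma cobar_delta_dd n :
  free_d cobar_delta (cobar_delta n) = - (n ⊗ₜ cdga_curv A).
Proof.
rewrite [X in free_d _ X]cobar_deltaE linearD free_d1 cobar_deltaE.
rewrite dgn_dd pure0l add0r.
rewrite dgn_coder (linearD twist) cobar_twist_eq dgn_coactA subrr addr0.
by rewrite curvature_counit dgn_counit.
Qed.

Definition cobar : cdgModule A := free_cdgModule cobar_delta_deg cobar_delta_dd.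

Section Universal.
Variable M : cdgModule A.

Lemma free_extend_twist (f : {linear N -> M}) y :
  free_extend f (twist y) = cdgm_act M (koszul 1 f tau y).
Proof.
elim/tens_ind: y => [|y z hy hz|n x].
- by rewrite !linear0.
- by rewrite (linearD twist) (linearD (free_extend f)) hy hz !linearD.
- by rewrite !koszul1_pure free_extend_pure.
Qed.

(** The tangent equation at f is the condition that the A-linear extension of f
    intertwines the predifferentials on the generators n ⊗ 1. *)
Lemma tangent_cobarE (f : {linear N -> M}) : is_tangent tau f <->
  has_degree 0 f /\ forall n, free_extend f (cobar_delta n) = cdgm_d M (f n).
Proof.
have eqE n : free_extend f (cobar_delta n) =
    f (dgn_d N n) + cdgm_act M (koszul 1 f tau (dgn_coact N n)).
  by rewrite cobar_deltaE linearD free_extend_pure cdgm_act1 free_extend_twist.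
split=> [/is_tangentE[hf fE]|[hf fE]].
  split=> // n; apply/esym/eqP; rewrite eqE -subr_eq0 opprD addrA; exact/eqP/fE.
by apply/is_tangentE; split=> // n; rewrite -fE eqE -addrA -opprD subrr.
Qed.

Fact cobar_to_tangent_subproof (F : cdgHom cobar M) :
  (F \o free_gen A N : {linear N -> M}) \in @tangent_pred k A C tau N M.
Proof.
have [hF _ Fd] := cdgHomP F.
apply/asboolP/tangent_cobarE; split=> [p n hn|n].
  have := hF _ _ (homog_pure hn (cdga_one_homog A)); rewrite addr0; exact.
by rewrite -(free_hom_extend (F := F)) // -(free_d1 cobar_delta n); apply: Fd.
Qed.

Definition cobar_to_tangent (F : cdgHom cobar M) : tangent tau N M :=
  Tangent (cobar_to_tangent_subproof F).

Fact cobar_to_tangent_linear : linear cobar_to_tangent.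
Proof. by move=> a f g; apply: tangent_ext. Qed.

Fact tangent_to_cobar_subproof (f : tangent tau N M) :
  (free_extend f : {linear cobar -> M}) \in @cdg_hom_pred k A cobar M.
Proof.
have /tangent_cobarE[hf fE] := tangentP f.
by apply/asboolP/free_extend_hom.
Qed.

Definition tangent_to_cobar (f : tangent tau N M) : cdgHom cobar M :=
  CdgHom (tangent_to_cobar_subproof f).

Fact tangent_to_cobar_linear : linear tangent_to_cobar.
Proof.
move=> a f g; apply: cdgHom_ext => x.
rewrite -[LHS]/(cdgm_act M (tmap (a *: (f : {linear N -> M}) + g) idfun x)).
by rewrite tmap_linP; apply: linearP.
Qed.

Lemma cobar_to_tangentK : cancel cobar_to_tangent tangent_to_cobar.
Proof. by move=> F; apply: cdgHom_ext => x; apply/esym/free_hom_extend. Qed.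

Lemma tangent_to_cobarK : cancel tangent_to_cobar cobar_to_tangent.
Proof.
move=> f; apply: tangent_ext => n.
by rewrite -[LHS]/(free_extend f (n ⊗ₜ cdga_one A)) free_extend_pure cdgm_act1.
Qed.

End Universal.

Program Definition cobar_nat_trans : nat_trans (corep_functor cobar) (TMC tau N) :=
  @NatTrans _ _ (corep_functor cobar) (TMC tau N)
    (fun M => mklin (cobar_to_tangent_linear (M := M))) _.
Next Obligation. by move=> M M' u; apply: lin_ext => F; apply: tangent_ext. Qed.

Definition cobar_nat_iso : nat_iso (corep_functor cobar) (TMC tau N).
Proof.
exists cobar_nat_trans => M; exists (mklin (tangent_to_cobar_linear (M := M))).
by split; apply: lin_ext; [apply: cobar_to_tangentK|apply: tangent_to_cobarK].
Defined.

End Comodule.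

(** * Functoriality of the cobar construction *)

(** The universal tangent vector n |-> n ⊗ 1. *)
Definition cobar_unit N : tangent tau N (cobar N) :=
  cobar_to_tangent (cdg_id (cobar N)).

Lemma cobar_hom_ext N (M : cdgModule A) (F G : cdgHom (cobar N) M) :
  (forall n, F (n ⊗ₜ cdga_one A) = G (n ⊗ₜ cdga_one A)) -> F = G.
Proof.
by move=> FG; apply: (can_inj (@cobar_to_tangentK N M)); apply: tangent_ext.
Qed.

Definition cobar_map N N' (g : comHom N N') : cdgHom (cobar N) (cobar N') :=
  tangent_to_cobar (tangent_pre g (cobar_unit N')).

Lemma cobar_mapE N N' (g : comHom N N') n :
  cobar_map g (n ⊗ₜ cdga_one A) = g n ⊗ₜ cdga_one A.
Proof.
have /(congr1 (fun f : tangent tau N (cobar N') => f n)) :=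
  tangent_to_cobarK (tangent_pre g (cobar_unit N')).
exact.
Qed.

Program Definition cobar_functor : functor (ComCat C) (CdgModCat A) :=
  @Functor (ComCat C) (CdgModCat A) cobar cobar_map _ _.
Next Obligation. by move=> N; apply: cobar_hom_ext => n; rewrite cobar_mapE. Qed.
Next Obligation.
move=> N N' N'' g f; apply: cobar_hom_ext => n; rewrite cobar_mapE.
by rewrite -[RHS]/(cobar_map g (cobar_map f _)) !cobar_mapE.
Qed.

End Cobar.

Theorem mainTheorem9 (k : comPzRingType) (A : cdgAlgebra k) (C : dgCoalgebra k)
    (tau : mcSolution A C) :
  (forall N : dgComodule C, corepresentable (TMC tau N)) /\
  exists (F : functor (ComCat C) (CdgModCat A))
         (phi : forall N : dgComodule C,
                  nat_iso (corep_functor (F N)) (TMC tau N)),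
    forall (N N' : dgComodule C) (g : comHom N N') (M : cdgModule A),
      cat_comp (phi N M) (corep_pre (functor_map F g) M) =
      cat_comp (TMC_pre tau g M) (phi N' M).
Proof.
split=> [N|]; first by exists (cobar tau N); constructor; apply: cobar_nat_iso.
exists (cobar_functor tau), (fun N => cobar_nat_iso tau N) => N N' g M.
apply: lin_ext => F; apply: tangent_ext => n.
exact: (congr1 F (cobar_mapE tau g n)).
Qed.
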